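(* Every unbounded metric space is divisible.
   Context: A metric space $\mathbb{M}=(M;d)$ (of arbitrary cardinality) is divisible if there is a partition of $M$ into two parts, neither of which contains an isometric copy of $\mathbb{M}$. It is unbounded if the set of its distances is unbounded in $\mathbb{R}$. *)

(* Defs.v *)
From mathcomp Require Import all_boot all_order all_algebra.
From mathcomp Require Import all_classical all_reals all_analysis.

Set Implicit Arguments.
Unset Strict Implicit.
Unset Printing Implicit Defensive.

Import Order.TTheory GRing.Theory Num.Theory.
Import numFieldNormedType.Exports.

Local Open Scope classical_set_scope.
Local Open Scope ring_scope.

Definition isometry (R : realType) (M N : metricType R) (f : M -> N) : Prop :=
  forall x y : M, mdist (f x) (f y) = mdist x y.

(* An isometric copy of M inside A is the range of a distance-preserving
   (hence injective) map, which need not be onto A. *)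
Definition contains_copy (R : realType) (M : metricType R) (A : set M) : Prop :=
  exists f : M -> M, isometry f /\ range f `<=` A.

(* [partition] also asks for nonempty parts; this is no restriction here, since
   the part complementary to an empty one would be the whole space. *)
Definition divisible (R : realType) (M : metricType R) : Prop :=
  exists P : bool -> set M,
    partition [set: bool] P [set: M] /\ forall b : bool, ~ contains_copy (P b).

Definition distances (R : realType) (M : metricType R) : set R :=
  [set mdist p.1 p.2 | p in [set: M * M]].

Definition unbounded (R : realType) (M : metricType R) : Prop :=
  ~ bounded_set (distances M).

(* Main.v *)
Require Import Defs.
From mathcomp Require Import all_boot all_order all_algebra.
From mathcomp Require Import all_classical all_reals all_analysis.
From mathcomp Require Import lra zify.

(** Measure every point by its distance to a fixed base point [a].  An isometric
    self-embedding [f] changes this distance by at most the constant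
    [mdist a (f a)] ([isometry_radius]), although it may move individual points
    arbitrarily far.  In an unbounded space one can pick points [x 0, x 1, ...]
    going off to infinity so fast that the rings
    [{y | |mdist a y - mdist a (x k)| <= k}], whose widths tend to infinity, are
    still pairwise disjoint ([exists_sparse_seq], [ring_inj]).  Once [k] exceeds
    [mdist a (f a)], the point [f (x k)] lies in the same ring as [x k]; so the
    range of [f] meets all but finitely many of the rings.  Put the rings of
    even index in one part and everything else, hence the rings of odd index,
    in the other: no range of an isometric embedding avoids either part. *)

Set Implicit Arguments.
Unset Strict Implicit.
Unset Printing Implicit Defensive.

Import Order.TTheory GRing.Theory Num.Theory.

Local Open Scope classical_set_scope.
Local Open Scope ring_scope.

Lemma unbounded_pair (R : realType) (M : metricType R) (t : R) :
  unbounded M -> exists p q : M, t < mdist p q.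
Proof.
move=> unbM; apply: contrapT => noPair; apply: unbM.
exists t; split; first exact: num_real.
move=> s ts _ /= [[p q] _ <-] /=.
rewrite ger0_norm ?mdist_ge0 //; apply: le_trans (ltW ts).
by rewrite leNgt; apply/negP => tpq; apply: noPair; exists p, q.
Qed.

Lemma unbounded_far (R : realType) (M : metricType R) (a : M) (t : R) :
  unbounded M -> exists x : M, t <= mdist a x.
Proof.
move=> /(unbounded_pair (t + t)) [p [q tpq]].
have := metric_triangle p a q; rewrite (metric_sym p a) => tri.
have [tp|pt] := leP t (mdist a p); first by exists p.
by exists q; lra.
Qed.

(** The triangle inequality applied to [a], [f a], [f x], in both directions. *)
Lemma isometry_radius (R : realType) (M : metricType R) (f : M -> M) (a x : M) :
  Defs.isometry f -> `|mdist a (f x) - mdist a x| <= mdist a (f a).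
Proof.
move=> fI; rewrite -(fI a x) ler_norml.
have := metric_triangle a (f a) (f x).
have := metric_triangle (f a) a (f x); rewrite (metric_sym (f a) a).
by move=> ? ?; apply/andP; split; lra.
Qed.

Lemma exists_sparse_seq (R : realType) (M : metricType R) (a : M) :
  unbounded M -> exists x : nat -> M, forall j k : nat, (j < k)%N ->
    mdist a (x j) + j%:R < mdist a (x k) - k%:R.
Proof.
move=> unbM; have /choice [g gP] := fun t => @unbounded_far _ _ a t unbM.
(* Step [k] has to clear the half-widths [k] and [k + 1] of two consecutive
   rings; the last unit makes the inequality strict. *)
pose x := fix x k := if k is k'.+1
  then g (mdist a (x k') + k'%:R + k'.+1%:R + 1) else a.
exists x => j; elim=> // k IHk.
have := gP (mdist a (x k) + k%:R + k.+1%:R + 1); rewrite -/(x k.+1) => step.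
rewrite ltnS leq_eqVlt => /predU1P [-> | /IHk IH]; first by lra.
have : 0 <= k%:R :> R by [].
lra.
Qed.

Lemma ring_inj (R : realType) (r : nat -> R) (s : R) (j k : nat) :
    (forall i l : nat, (i < l)%N -> r i + i%:R < r l - l%:R) ->
  `|s - r j| <= j%:R -> `|s - r k| <= k%:R -> j = k.
Proof.
move=> sparse; rewrite !ler_norml => /andP[j1 j2] /andP[k1 k2].
by case: (ltngtP j k) => // /sparse lt_rings; exfalso; lra.
Qed.

Theorem theorem3p12 (R : realType) (M : metricType R) :
  unbounded M -> divisible M.
Proof.
move=> unbM; have [a _] := unbounded_pair 0 unbM.
have [x sparse] := exists_sparse_seq a unbM.
pose ring k := [set y | `|mdist a y - mdist a (x k)| <= k%:R].
pose A := [set y | exists2 k, ~~ odd k & ring k y].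
have xring k : ring k (x k) by rewrite /ring /= subrr normr0.
have ringA k y : ring k y -> A y -> ~~ odd k.
  by move=> ky [j oddj jy]; rewrite (ring_inj sparse ky jy).
exists (fun b => if b then A else ~` A); split; first split.
- apply/seteqP; split=> // y _; have [Ay | nAy] := pselect (A y).
  + by exists true.
  + by exists false.
- by case=> -[] _ _ [y [/= ]].
- case=> _ /=; first by exists (x 0%N), 0%N.
  by exists (x 1%N) => /(ringA 1%N _ (xring 1%N)).
move=> b [f [fI fP]].
(* From this [n] on, half-widths are at least the displacement of [a], so [f]
   cannot push the center of a ring out of it. *)
have [n rn] : exists n : nat, mdist a (f a) <= n%:R.
  by exists (Num.bound (mdist a (f a))); apply/ltW/archi_boundP/mdist_ge0.
have fring k : (n <= k)%N -> ring k (f (x k)).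
  move=> nk; apply: le_trans (isometry_radius a (x k) fI) _.
  by apply: le_trans rn _; rewrite ler_nat.
case: b fP => fP.
- have Afx : A (f (x n.*2.+1)) by apply: fP; exists (x n.*2.+1).
  have /fring /ringA /(_ Afx) : (n <= n.*2.+1)%N by lia.
  by rewrite /= odd_double.
- have /= : (~` A) (f (x n.*2)) by apply: fP; exists (x n.*2).
  by apply; exists n.*2; [rewrite odd_double | apply: fring; lia].
Qed.
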